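(* Let $E_1,E_2,E_3,H$ be any logically independent events, with $H\neq\emptyset$. Then the set $\Pi$ of all coherent assessments $\mathcal{M}=(x_1,x_2,x_3,x_{12},x_{13},x_{23},x_{123})$ on $$\mathcal{F}=\{E_1|H,\,E_2|H,\,E_3|H,\,(E_1|H)\wedge(E_2|H),\,(E_1|H)\wedge(E_3|H),\,(E_2|H)\wedge(E_3|H),\,(E_1|H)\wedge(E_2|H)\wedge(E_3|H)\}$$ is the set of points $(x_1,x_2,x_3,x_{12},x_{13},x_{23},x_{123})$ which satisfy the following conditions: $$\left\{\begin{array}{l} (x_1,x_2,x_3)\in[0,1]^3,\\ \max\{x_1+x_2-1,\,x_{13}+x_{23}-x_3,\,0\}\leq x_{12}\leq\min\{x_1,x_2\},\\ \max\{x_1+x_3-1,\,x_{12}+x_{23}-x_2,\,0\}\leq x_{13}\leq\min\{x_1,x_3\},\\ \max\{x_2+x_3-1,\,x_{12}+x_{13}-x_1,\,0\}\leq x_{23}\leq\min\{x_2,x_3\},\\ 1-x_1-x_2-x_3+x_{12}+x_{13}+x_{23}\geq 0,\\ x_{123}\geq\max\{0,\,x_{12}+x_{13}-x_1,\,x_{12}+x_{23}-x_2,\,x_{13}+x_{23}-x_3\},\\ x_{123}\leq\min\{x_{12},\,x_{13},\,x_{23},\,1-x_1-x_2-x_3+x_{12}+x_{13}+x_{23}\}. \end{array}\right.$$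
   Context: Events are two-valued propositions (identified with subsets of the sure event $\Omega$, and with their indicators); $\overline{A}$ is negation, $AB$ is conjunction. Events $A_1,\ldots,A_r$ are logically independent if all $2^r$ conjunctions $\bigwedge_i A_i^{*}$, with $A_i^*\in\{A_i,\overline{A}_i\}$, are possible (nonempty). For events $E,H$ with $H\neq\emptyset$, the conditional event $E|H$ is true if $EH$ is true, false if $\overline{E}H$ is true, void if $\overline{H}$ is true. A conditional random quantity $X|H$ ($X$ with finitely many values) with assessed prevision $\mu=\mathbb{P}(X|H)$ is identified with the random quantity $XH+\mu\overline{H}$; in particular $E|H=EH+x\overline{H}$ with $x=P(E|H)$. Coherence: an assessment of previsions $\mu_j=\mathbb{P}(X_j|K_j)$ on a family of conditional random quantities is coherent if, for every finite subfamily $\{X_1|K_1,\ldots,X_r|K_r\}$ and all real $s_1,\ldots,s_r$, the gain $G=\sum_j s_jK_j(X_j-\mu_j)$ restricted to $K_1\vee\cdots\vee K_r$ satisfies $\min G\leq 0\leq\max G$. Conjunctions. Set $H_1=H_2=H_3=H$, $x_i=P(E_i|H_i)$, $x_{ij}=x_{ji}=\mathbb{P}[(E_i|H_i)\wedge(E_j|H_j)]$, $x_{123}=\mathbb{P}[(E_1|H_1)\wedge(E_2|H_2)\wedge(E_3|H_3)]$; write $x_S$ for the number indexed by nonempty $S\subseteq\{1,2,3\}$. The conjunction $\bigwedge_{i\in S}(E_i|H_i)$ is the random quantity, conditional on $\bigvee_{i\in S}H_i$, with value $1$ if all $E_i|H_i$, $i\in S$, are true; $0$ if at least one is false; $x_V$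 if none is false and the set $V\subseteq S$ of indices of void ones is nonempty (so its value is its prevision $x_S$ when all $H_i$, $i\in S$, are false). *)

(* Defs.v *)
From mathcomp Require Import all_boot all_order all_algebra.
From mathcomp Require Import mathcomp_extra boolp classical_sets reals numfun.
Set Implicit Arguments.
Unset Strict Implicit.
Unset Printing Implicit Defensive.
Import Order.TTheory GRing.Theory Num.Theory.
Local Open Scope classical_set_scope.
Local Open Scope ring_scope.

(* The sure event is the whole type [T]; events are sets [A : set T], with
   indicator [\1_A]; possible means nonempty. *)

Definition logically_independent (T : Type) (r : nat) (A : r.-tuple (set T)) :
    Prop :=
  forall b : 'I_r -> bool,
    (\bigcap_(i : 'I_r) (if b i then tnth A i else ~` tnth A i)) !=set0.

(* [X | K]: only the values of [crq_val] on [crq_cond] are relevant; outside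
   [crq_cond] the conditional random quantity takes its prevision as value. *)
Record cond_rq (T : Type) (R : realType) := CondRQ {
  crq_val : T -> R;
  crq_cond : set T
}.

Definition cond_event (T : Type) (R : realType) (E H : set T) : cond_rq T R :=
  CondRQ \1_E H.

Definition ce_true (T : Type) (E H : set T) : set T := E `&` H.
Definition ce_false (T : Type) (E H : set T) : set T := ~` E `&` H.
Definition ce_void (T : Type) (H : set T) : set T := ~` H.

Definition void_indices (T : Type) (n : nat) (H : 'I_n -> set T)
    (S : {set 'I_n}) (w : T) : {set 'I_n} :=
  [set i in S | w \in ce_void (H i)]%SET.

(* [x V] is the prevision of the conjunction of the [E i | H i], [i \in V].
   In the last branch [V] is nonempty whenever [S] is, so [x] is never
   evaluated at the empty set for nonempty [S]. *)
Definition conj_rq (T : Type) (R : realType) (n : nat) (E H : 'I_n -> set T)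
    (x : {set 'I_n} -> R) (S : {set 'I_n}) : cond_rq T R :=
  CondRQ
    (fun w =>
       if [forall i in S, w \in ce_true (E i) (H i)] then 1
       else if [exists i in S, w \in ce_false (E i) (H i)] then 0
       else x (void_indices H S w))
    (\bigcup_(i in [set` S]) H i).

Definition gain (T : Type) (R : realType) (r : nat) (Q : 'I_r -> cond_rq T R)
    (mu s : 'I_r -> R) (w : T) : R :=
  \sum_(j < r) s j * (\1_(crq_cond (Q j)) w * (crq_val (Q j) w - mu j)).

Definition is_min (R : realType) (A : set R) (m : R) : Prop :=
  A m /\ lbound A m.
Definition is_max (R : realType) (A : set R) (m : R) : Prop :=
  A m /\ ubound A m.

(* Meant for finitely-valued random quantities, for which the minimum and the
   maximum exist.  A finite nonempty subfamily is an injective [f]. *)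
Definition coherent (T : Type) (R : realType) (I : Type)
    (Q : I -> cond_rq T R) (mu : I -> R) : Prop :=
  forall (r : nat) (f : 'I_r.+1 -> I), injective f ->
  forall s : 'I_r.+1 -> R,
    let G := gain (Q \o f) (mu \o f) s @`
               (\bigcup_(j : 'I_r.+1) crq_cond (Q (f j))) in
    exists m M : R, [/\ is_min G m, is_max G M & m <= 0 <= M].

(* Indices 1, 2, 3 are encoded as 0, 1, 2 in ['I_3]. *)
Definition i1 : 'I_3 := @Ordinal 3 0 isT.
Definition i2 : 'I_3 := @Ordinal 3 1 isT.
Definition i3 : 'I_3 := @Ordinal 3 2 isT.

(* [V |-> x_V]; the value 0 at the empty set is junk. *)
Definition x_of (R : realType) (x1 x2 x3 x12 x13 x23 x123 : R)
    (V : {set 'I_3}) : R :=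
  match i1 \in V, i2 \in V, i3 \in V with
  | true, false, false => x1
  | false, true, false => x2
  | false, false, true => x3
  | true, true, false => x12
  | true, false, true => x13
  | false, true, true => x23
  | true, true, true => x123
  | false, false, false => 0
  end.

Definition family (T : Type) (R : realType) (E1 E2 E3 H : set T)
    (x : {set 'I_3} -> R) : 7.-tuple (cond_rq T R) :=
  let conj S := conj_rq (tnth [tuple E1; E2; E3]) (fun=> H) x S in
  [tuple cond_event R E1 H; cond_event R E2 H; cond_event R E3 H;
         conj [set i1; i2]%SET; conj [set i1; i3]%SET; conj [set i2; i3]%SET;
         conj [set i1; i2; i3]%SET].

(* The values of the conjunctions depend on the assessment itself, through the
   [x_V], so the family is built from the point being tested. *)
Definition coherent_assessment (T : Type) (R : realType) (E1 E2 E3 H : set T)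
    (x1 x2 x3 x12 x13 x23 x123 : R) : Prop :=
  coherent
    (tnth (family E1 E2 E3 H (x_of x1 x2 x3 x12 x13 x23 x123)))
    (tnth [tuple x1; x2; x3; x12; x13; x23; x123]).

(* Main.v *)
Require Import Defs.
From mathcomp Require Import all_boot all_order all_algebra.
From mathcomp Require Import mathcomp_extra boolp classical_sets reals numfun.
From mathcomp Require Import ring lra.
Import Order.TTheory GRing.Theory Num.Theory.
Local Open Scope classical_set_scope.
Local Open Scope ring_scope.

(** All seven conditional random quantities share the conditioning event [H],
    and on [H] no [E_i|H] is void, so there a conjunction is just the product
    of the indicators of its events.  Its values therefore depend only on the
    atom of [E1, E2, E3] that occurs: they are the vertices of a polytope in
    dimension 7, one vertex for each of the 8 atoms.

    Coherence then means that the assessment lies in the convex hull of these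
    vertices.  In one direction ([coherent_affine_ge0]), an affine form that is
    nonnegative at every vertex is nonnegative at a coherent assessment, because
    a stake vector given by its linear part produces a gain whose minimum would
    otherwise be positive.  In the other ([coherent_of_mixture]), if the
    assessment is a mixture of the vertices then the same mixture of the values
    of any gain is 0, so the gain cannot keep a strict sign; logical
    independence is what makes every vertex an actual value on [H].

    The 8 vertices are affinely independent: they span a simplex, whose
    barycentric coordinates are the probabilities that inclusion-exclusion
    assigns to the atoms ([atom_weight]).  The convex hull is thus cut out by
    the 8 inequalities saying that these coordinates are nonnegative.  These
    are the lower and upper bounds on [x123], and the remaining inequalities of
    the system are sums of them. *)

(** * Coherence under a common conditioning event *)

Section CommonCondition.
Variables (T : Type) (R : realType).

Lemma gain_on_condition (r : nat) (Q : 'I_r -> cond_rq T R) (mu s : 'I_r -> R)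
    (H : set T) (w : T) :
  (forall j, crq_cond (Q j) = H) -> H w ->
  gain Q mu s w = \sum_(j < r) s j * (crq_val (Q j) w - mu j).
Proof.
move=> QH Hw; apply: eq_bigr => j _.
by rewrite QH indicE mem_set // mul1r.
Qed.

(** The least gain for the stakes [s] is attained at some outcome in [H] and is
    at most 0; the hypothesis bounds the quantity at that outcome from below. *)
Lemma coherent_linear_ge (r : nat) (Q : 'I_r.+1 -> cond_rq T R)
    (mu s : 'I_r.+1 -> R) (H : set T) (b : R) :
  (forall j, crq_cond (Q j) = H) -> coherent Q mu ->
  (forall w, H w -> b <= \sum_j s j * crq_val (Q j) w) ->
  b <= \sum_j s j * mu j.
Proof.
move=> QH /(_ r id (@inj_id _) s) [m [M [[[w [j _ Hw] <-] _] _ /andP[m0 _]]]] sb.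
rewrite /= QH in Hw; apply: le_trans (sb w Hw) _; rewrite -subr_le0.
move: m0; rewrite (gain_on_condition _ _ _ _ H) //= => m0.
by rewrite -sumrB; under eq_bigr do rewrite -mulrBr.
Qed.

(** The mixture of the gains with the weights [lam] is 0 by linearity, hence 0
    lies between the extreme gains; these exist because the gain on [H] only
    depends on the index [c w], which has finitely many values. *)
Lemma coherent_of_mixture (I : Type) (C : finType) (Q : I -> cond_rq T R)
    (mu : I -> R) (H : set T) (c : T -> C) (phi : I -> C -> R) (lam : C -> R) :
  (forall i, crq_cond (Q i) = H) ->
  (forall i w, H w -> crq_val (Q i) w = phi i (c w)) ->
  (forall k, exists2 w, H w & c w = k) ->
  (forall k, 0 <= lam k) -> \sum_k lam k = 1 ->
  (forall i, mu i = \sum_k lam k * phi i k) ->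
  coherent Q mu.
Proof.
move=> QH Qphi c_surj lam0 lam1 mu_mix r f _ s.
pose g k := \sum_j s j * (phi (f j) k - mu (f j)).
have gainE w : H w -> gain (Q \o f) (mu \o f) s w = g (c w).
  move=> Hw; rewrite (gain_on_condition _ _ _ _ H w (fun j => QH (f j)) Hw).
  by apply: eq_bigr => j _ /=; rewrite Qphi.
have mix0 : \sum_k lam k * g k = 0.
  under eq_bigr do rewrite mulr_sumr.
  rewrite exchange_big big1 //= => j _.
  under eq_bigr do rewrite mulrCA mulrBr.
  by rewrite -mulr_sumr sumrB -mulr_suml lam1 mul1r -mu_mix subrr mulr0.
have [k0 _] : exists k0 : C, true.
  case: (pickP (fun _ : C => true)) => [k0 _|C0]; first by exists k0.
  by move/eqP: lam1; rewrite big_pred0 // eq_sym oner_eq0.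
case: (arg_minP g (isT : xpredT k0)) => kmin _ gmin.
case: (arg_maxP g (isT : xpredT k0)) => kmax _ gmax.
set G := _ @` _; have GE y : G y <-> exists k, y = g k.
  split=> [[w [j _ Hw] <-]|[k ->]].
    by exists (c w); apply: gainE; rewrite -(QH (f j)).
  have [w Hw <-] := c_surj k; exists w; last exact: gainE.
  by exists ord0 => //; rewrite QH.
exists (g kmin), (g kmax); split.
- by split; [apply/GE; exists kmin | move=> y /GE[k ->]; exact: gmin].
- by split; [apply/GE; exists kmax | move=> y /GE[k ->]; exact: gmax].
- have min_mix : \sum_k lam k * g kmin = g kmin by rewrite -mulr_suml lam1 mul1r.
  have max_mix : \sum_k lam k * g kmax = g kmax by rewrite -mulr_suml lam1 mul1r.
  apply/andP; split.
    rewrite -min_mix -[leRHS]mix0; apply: ler_sum => k _.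
    by apply: ler_wpM2l => //; exact: gmin.
  rewrite -max_mix -[leLHS]mix0; apply: ler_sum => k _.
  by apply: ler_wpM2l => //; exact: gmax.
Qed.

Lemma conj_rq_val (n : nat) (E : 'I_n -> set T) (H : set T)
    (x : {set 'I_n} -> R) (S : {set 'I_n}) (w : T) :
  H w -> crq_val (conj_rq E (fun=> H) x S) w = \prod_(i in S) \1_(E i) w.
Proof.
move=> Hw; have HwT : w \in H by rewrite inE.
have trueE i : (w \in ce_true (E i) H) = (w \in E i).
  by rewrite /ce_true in_setI HwT andbT.
have falseE i : (w \in ce_false (E i) H) = (w \notin E i).
  by rewrite /ce_false in_setI HwT andbT in_setC.
rewrite /conj_rq /=; case: ifP => [/forall_inP allE|/negbT].
  by rewrite big1 // => i /allE; rewrite trueE indicE => ->.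
rewrite negb_forall_in => /exists_inP[i iS]; rewrite trueE => niE.
have -> : [exists i in S, w \in ce_false (E i) H].
  by apply/exists_inP; exists i; rewrite ?falseE.
by rewrite (bigD1 i) //= indicE (negbTE niE) mul0r.
Qed.

End CommonCondition.

(** * The seven quantities on [H] *)

Definition atom_of {T : Type} (E1 E2 E3 : set T) (w : T) : bool * bool * bool :=
  (w \in E1, w \in E2, w \in E3).

Definition vertex (R : realType) (k : bool * bool * bool) : 7.-tuple R :=
  let: (a, b, c) := k in
  [tuple a%:R; b%:R; c%:R; a%:R * b%:R; a%:R * c%:R; b%:R * c%:R;
         a%:R * b%:R * c%:R].

Section Family.
Variables (T : Type) (R : realType) (E1 E2 E3 H : set T).

Lemma family_cond (x : {set 'I_3} -> R) (j : 'I_7) :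
  crq_cond (tnth (Defs.family E1 E2 E3 H x) j) = H.
Proof.
case: j; do 7?[case=> //]; move=> p; rewrite (tnth_nth (cond_event R E1 H)) //=;
  by apply: bigcup_const; (exists i1 + exists i2); rewrite /= !inE.
Qed.

Lemma family_val (x : {set 'I_3} -> R) (j : 'I_7) (w : T) :
  H w ->
  crq_val (tnth (Defs.family E1 E2 E3 H x) j) w
  = tnth (vertex R (atom_of E1 E2 E3 w)) j.
Proof.
move=> Hw; have conjE S := conj_rq_val T R _ (tnth [tuple E1; E2; E3]) H x S w Hw.
rewrite /= in conjE; rewrite (tnth_nth (cond_event R E1 H)) (tnth_nth 0).
case: j; do 7?[case=> [|]] => //= p; rewrite ?indicE //.
all: rewrite conjE -?finset.setUA ?big_setU1 ?big_set1 ?inE //=.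
all: by rewrite ?(tnth_nth set0) /= ?indicE ?mulrA.
Qed.

Lemma atom_of_surj (indep : logically_independent [tuple E1; E2; E3; H])
    (k : bool * bool * bool) : exists2 w, H w & atom_of E1 E2 E3 w = k.
Proof.
case: k => [[a b] c].
have [w wP] := indep (tnth [tuple a; b; c; true]).
have memE j (A := tnth [tuple E1; E2; E3; H] j) :
    (w \in A) = tnth [tuple a; b; c; true] j.
  move: (wP j I); rewrite -/A; case: ifP => _ wA; first exact: mem_set.
  by apply/negbTE; apply/negP => /set_mem.
exists w; first by apply/set_mem; exact: (memE (@Ordinal 4 3 isT)).
by congr (_, _, _);
  [exact: (memE (@Ordinal 4 0 isT)) | exact: (memE (@Ordinal 4 1 isT))
  |exact: (memE (@Ordinal 4 2 isT))].
Qed.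

(** It suffices to test an affine form at the vertices: the stakes are its
    linear coefficients. *)
Lemma coherent_affine_ge0 (x1 x2 x3 x12 x13 x23 x123 : R)
    (s0 s1 s2 s3 s12 s13 s23 s123 : R) :
  coherent_assessment E1 E2 E3 H x1 x2 x3 x12 x13 x23 x123 ->
  (forall a b c : bool,
     0 <= s0 + s1 * a%:R + s2 * b%:R + s3 * c%:R + s12 * (a%:R * b%:R)
          + s13 * (a%:R * c%:R) + s23 * (b%:R * c%:R)
          + s123 * (a%:R * b%:R * c%:R)) ->
  0 <= s0 + s1 * x1 + s2 * x2 + s3 * x3 + s12 * x12 + s13 * x13 + s23 * x23
       + s123 * x123.
Proof.
move=> coh s_ge0; pose s := tnth [tuple s1; s2; s3; s12; s13; s23; s123].
have := @coherent_linear_ge T R 6 _ _ s H (- s0) (family_cond _) coh.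
rewrite !big_ord_recl big_ord0 /s !(tnth_nth 0) /= => main.
suff /main : forall w, H w -> - s0 <= \sum_j s j * crq_val
    (tnth (Defs.family E1 E2 E3 H (x_of x1 x2 x3 x12 x13 x23 x123)) j) w by lra.
move=> w Hw; under eq_bigr do rewrite family_val //.
rewrite !big_ord_recl big_ord0 /s !(tnth_nth 0) /=.
by have := s_ge0 (w \in E1) (w \in E2) (w \in E3); lra.
Qed.

End Family.

(** * The simplex of the atoms *)

(** Inclusion-exclusion: the probability of the atom [k], when each [x_S] is
    the probability of the intersection of the events with index in [S]. *)
Definition atom_weight {R : realType} (x1 x2 x3 x12 x13 x23 x123 : R)
    (k : bool * bool * bool) : R :=
  match k with
  | (true, true, true) => x123
  | (true, true, false) => x12 - x123
  | (true, false, true) => x13 - x123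
  | (false, true, true) => x23 - x123
  | (true, false, false) => x1 - x12 - x13 + x123
  | (false, true, false) => x2 - x12 - x23 + x123
  | (false, false, true) => x3 - x13 - x23 + x123
  | (false, false, false) => 1 - x1 - x2 - x3 + x12 + x13 + x23 - x123
  end.

Lemma sum_atoms (R : realType) (F : bool * bool * bool -> R) :
  \sum_k F k = F (true, true, true) + F (true, true, false)
    + F (true, false, true) + F (true, false, false)
    + F (false, true, true) + F (false, true, false)
    + F (false, false, true) + F (false, false, false).
Proof.
transitivity (\sum_a \sum_b \sum_c F (a, b, c)).
  by rewrite !pair_bigA; apply: eq_bigr => -[[a b] c].
by rewrite !big_bool /= !addrA.
Qed.

(** Each weight is an affine form which is 1 at its own vertex and 0 at the
    seven others, in particular nonnegative at every vertex; conversely the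
    weights are barycentric coordinates of the assessment. *)
Lemma coherent_atom_weight (T : Type) (R : realType) (E1 E2 E3 H : set T)
    (indep : logically_independent [tuple E1; E2; E3; H])
    (x1 x2 x3 x12 x13 x23 x123 : R) :
  coherent_assessment E1 E2 E3 H x1 x2 x3 x12 x13 x23 x123 <->
  forall k, 0 <= atom_weight x1 x2 x3 x12 x13 x23 x123 k.
Proof.
split=> [coh|weight_ge0].
  have ge0 s0 s1 s2 s3 s12 s13 s23 s123 :=
    coherent_affine_ge0 T R E1 E2 E3 H _ _ _ _ _ _ _
      s0 s1 s2 s3 s12 s13 s23 s123 coh.
  case=> [[[] []] []] /=.
  - by apply: le_trans (ge0 0 0 0 0 0 0 0 1 _) _; [do 3!case; rewrite /=; lra | lra].
  - by apply: le_trans (ge0 0 0 0 0 1 0 0 (-1) _) _; [do 3!case; rewrite /=; lra | lra].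
  - by apply: le_trans (ge0 0 0 0 0 0 1 0 (-1) _) _; [do 3!case; rewrite /=; lra | lra].
  - by apply: le_trans (ge0 0 1 0 0 (-1) (-1) 0 1 _) _; [do 3!case; rewrite /=; lra | lra].
  - by apply: le_trans (ge0 0 0 0 0 0 0 1 (-1) _) _; [do 3!case; rewrite /=; lra | lra].
  - by apply: le_trans (ge0 0 0 1 0 (-1) 0 (-1) 1 _) _; [do 3!case; rewrite /=; lra | lra].
  - by apply: le_trans (ge0 0 0 0 1 0 (-1) (-1) 1 _) _; [do 3!case; rewrite /=; lra | lra].
  - by apply: le_trans (ge0 1 (-1) (-1) (-1) 1 1 1 (-1) _) _; [do 3!case; rewrite /=; lra | lra].
apply: (@coherent_of_mixture _ _ _ _ _ _ H (atom_of E1 E2 E3)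
          (fun j k => tnth (vertex R k) j) _ _ _ _ weight_ge0).
- exact: family_cond.
- by move=> j w; exact: family_val.
- exact: atom_of_surj.
- by rewrite sum_atoms /=; ring.
- case; do 7?[case=> [|]] => //= p;
    by rewrite sum_atoms !(tnth_nth 0) /=; ring.
Qed.

Theorem theorem16 (T : Type) (R : realType) (E1 E2 E3 H : set T)
    (indep : logically_independent [tuple E1; E2; E3; H])
    (Hn0 : H !=set0)
    (x1 x2 x3 x12 x13 x23 x123 : R) :
  coherent_assessment E1 E2 E3 H x1 x2 x3 x12 x13 x23 x123
  <->
  [/\ [/\ 0 <= x1 <= 1, 0 <= x2 <= 1 & 0 <= x3 <= 1],
      Num.max (Num.max (x1 + x2 - 1) (x13 + x23 - x3)) 0 <= x12
        <= Num.min x1 x2,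
      Num.max (Num.max (x1 + x3 - 1) (x12 + x23 - x2)) 0 <= x13
        <= Num.min x1 x3,
      Num.max (Num.max (x2 + x3 - 1) (x12 + x13 - x1)) 0 <= x23
        <= Num.min x2 x3 &
      [/\ 0 <= 1 - x1 - x2 - x3 + x12 + x13 + x23,
          Num.max (Num.max 0 (x12 + x13 - x1))
                  (Num.max (x12 + x23 - x2) (x13 + x23 - x3)) <= x123 &
          x123 <= Num.min (Num.min x12 x13)
                          (Num.min x23
                             (1 - x1 - x2 - x3 + x12 + x13 + x23))]].
Proof.
rewrite coherent_atom_weight // !ge_max !le_min; split.
  move=> w; move: (w (true, true, true)) (w (true, true, false))
    (w (true, false, true)) (w (true, false, false)) (w (false, true, true))
    (w (false, true, false)) (w (false, false, true)) (w (false, false, false)).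
  move=> /= ? ? ? ? ? ? ? ?.
  by split; [split | | | | split]; rewrite -?andbA; repeat (apply/andP; split); lra.
case=> _ _ _ _ [_ /andP[/andP[? ?] /andP[? ?]]].
move=> /andP[/andP[? ?] /andP[? ?]].
by case=> [[[] []] []] /=; lra.
Qed.
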